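(* For any integers $n\ge 0$ and $\alpha\ge 1$, we have \[\mathrm{pod}\Big(5^{2\alpha+2}n+\frac{11\cdot 5^{2\alpha+1}+1}{8}\Big)\equiv 0\pmod 5\] and \[\mathrm{pod}\Big(5^{2\alpha+2}n+\frac{19\cdot 5^{2\alpha+1}+1}{8}\Big)\equiv 0\pmod 5.\]
   Context: For an integer $n\ge 0$, $\mathrm{pod}(n)$ denotes the number of partitions of $n$ in which the odd parts are distinct (even parts may repeat); equivalently $\sum_{n\ge 0}\mathrm{pod}(n)q^n=\prod_{i\ge 1}\frac{1+q^{2i-1}}{1-q^{2i}}$. *)

(* Defs.v *)
From mathcomp Require Import all_boot.

Set Implicit Arguments.
Unset Strict Implicit.
Unset Printing Implicit Defensive.

(* A partition of n is written as its weakly decreasing sequence of parts. *)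
Definition is_partition (n : nat) (p : seq nat) : bool :=
  [&& sorted geq p, all (leq 1) p & sumn p == n].

Definition odd_parts_distinct (p : seq nat) : bool := uniq (filter odd p).

(* A partition of n has at most n parts, all at most n, so it is no
   restriction to look for partitions in the finite type of sequences of
   length at most n over {0, ..., n}; see [partition_bseq]. *)
Definition pod (n : nat) : nat :=
  #|[set s : n.-bseq 'I_n.+1 |
      is_partition n (map val s) && odd_parts_distinct (map val s)]|.

Lemma partition_bseq (n : nat) (p : seq nat) :
  is_partition n p -> exists s : n.-bseq 'I_n.+1, map val s = p.
Proof.
case/and3P=> _ pos_p /eqP sum_p.
have le_size : size p <= n.
  rewrite -sum_p; elim: p pos_p {sum_p} => //= x p IHp /andP[x_gt0 /IHp].
  by rewrite -add1n => le_p; apply: leq_add.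
have le_part x : x \in p -> x < n.+1.
  rewrite ltnS -sum_p; elim: p {pos_p sum_p le_size} => //= y p IHp.
  rewrite inE => /predU1P[-> | /IHp le_x]; first exact: leq_addr.
  exact: leq_trans le_x (leq_addl _ _).
have szP : size (map (@inord n) p) <= n by rewrite size_map.
exists (Bseq szP); rewrite /= -map_comp -[RHS]map_id.
by apply/eq_in_map => x /le_part lt_x /=; rewrite inordK.
Qed.

(* The divisions by 8 in the arguments of pod are exact. *)
Lemma dvd8_offset (a : nat) :
  (8 %| 11 * 5 ^ (2 * a + 1) + 1) && (8 %| 19 * 5 ^ (2 * a + 1) + 1).
Proof.
have e : 5 ^ (2 * a + 1) = 5 %[mod 8].
  by rewrite addn1 expnS expnM -modnMmr -modnXm exp1n.
by rewrite /dvdn -![(_ * _ + 1) %% 8]modnDml -![(_ * 5 ^ _) %% 8]modnMmr e.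
Qed.

(* Main.v *)
(** Write pod(q) for the generating function of pod and
    phi(q) = \sum_(x = 1 mod 4) q^(x^2) = q psi(q^8), psi being Gauss's series
    \sum_j q^(j(j+1)/2).  Gauss's product for psi (obtained from Shanks's finite
    identity) gives pod(-q) psi(q) = 1, that is
    \sum_n (-1)^n pod(n) q^(8n-1) = 1/phi.

    Sorting the squares modulo 5 gives phi = A + B + phi(q^25), where A and B
    (phi1 and phi3) collect the x = 1, resp. 3, modulo 10, and multiplication by 2 + i on odd
    Gaussian integers gives A B = phi(q^5)^2 - phi(q^25)^2.  Let U keep the
    exponents divisible by 5 and divide them by 5.  Modulo 5 these identities
    yield U(phi^4) = phi^4, and since 1/phi = phi^4 / phi(q^5), also
    U(1/phi) = phi^3; and U(U(phi^3)) = 2 phi^3 - phi phi(q^5)^2.  The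
    coefficient of q^m in the last series vanishes if m = 1 or 4 modulo 5, and
    is that of phi^3 if 5 divides m.  Hence pod(N) = 0 modulo 5 whenever
    8N - 1 = 5^(2 alpha + 1) m with alpha > 0 and m = 1 or 4 modulo 5. *)

From HB Require Import structures.
Require Import Defs.
From mathcomp Require Import all_boot all_order all_algebra finfield boolp.
From mathcomp Require Import ring zify.

Set Implicit Arguments.
Unset Strict Implicit.
Unset Printing Implicit Defensive.

Import GRing.Theory.
Local Open Scope ring_scope.

(** * Formal power series *)

(** A series is its bare coefficient function, so equality of series is functional extensionality;
    the [eqType] and [choiceType] structures are classical. *)
Definition fps (R : Type) := nat -> R.

HB.instance Definition _ (R : Type) := gen_eqMixin (fps R).
HB.instance Definition _ (R : Type) := gen_choiceMixin (fps R).

Section Ring.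
Variable R : comNzRingType.
Implicit Types f g h : fps R.

Definition fps_add f g : fps R := fun n => f n + g n.
Definition fps_opp f : fps R := fun n => - f n.
Definition fpsC (a : R) : fps R := fun n => if n is 0 then a else 0.
Definition fps_mul f g : fps R := fun n => \sum_(i < n.+1) f i * g (n - i)%N.

(** Truncation to a polynomial: each coefficient of a product depends on finitely many terms, so the
    ring laws are inherited from polynomials. *)
Definition fps_poly n f := \poly_(i < n) f i.

Lemma coef_poly_mul N f g n : (n < N)%N ->
  (fps_poly N f * fps_poly N g)`_n = fps_mul f g n.
Proof.
move=> ltnN; rewrite coefM; apply: eq_bigr => i _; rewrite !coef_poly.
have le_in : (i <= n)%N by rewrite -ltnS.
by rewrite (leq_ltn_trans le_in ltnN) (leq_ltn_trans (leq_subr i n) ltnN).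
Qed.

Lemma fps_addA : associative fps_add.
Proof. by move=> f g h; apply: funext => n; apply: addrA. Qed.
Lemma fps_addC : commutative fps_add.
Proof. by move=> f g; apply: funext => n; apply: addrC. Qed.
Lemma fps_add0 : left_id (fpsC 0) fps_add.
Proof. by move=> f; apply: funext => -[|n]; apply: add0r. Qed.
Lemma fps_addN : left_inverse (fpsC 0) fps_opp fps_add.
Proof. by move=> f; apply: funext => -[|n]; apply: addNr. Qed.

HB.instance Definition _ :=
  GRing.isZmodule.Build (fps R) fps_addA fps_addC fps_add0 fps_addN.

Lemma fps_mulC : commutative fps_mul.
Proof.
by move=> f g; apply: funext => n; rewrite -!(@coef_poly_mul n.+1) // mulrC.
Qed.
Lemma fps_mulA : associative fps_mul.
Proof.
have coef_mull N f g h n : (n < N)%N ->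
    fps_mul (fps_mul f g) h n
      = (fps_poly N f * fps_poly N g * fps_poly N h)`_n.
  move=> ltnN; rewrite coefM; apply: eq_bigr => i _.
  have le_in : (i <= n)%N by rewrite -ltnS.
  rewrite coef_poly_mul ?(leq_ltn_trans le_in) //.
  by rewrite coef_poly (leq_ltn_trans (leq_subr i n) ltnN).
move=> f g h; apply: funext => n; rewrite fps_mulC.
by rewrite !(@coef_mull n.+1) //; congr ((polyseq _)`_n); ring.
Qed.
Lemma fps_mul1 : left_id (fpsC 1) fps_mul.
Proof.
move=> f; apply: funext => n; rewrite /fps_mul big_ord_recl mul1r subn0.
by rewrite big1 ?addr0 // => i _; apply: mul0r.
Qed.
Lemma fps_mulDl : left_distributive fps_mul fps_add.
Proof.
move=> f g h; apply: funext => n; rewrite /fps_mul /fps_add -big_split /=.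
by apply: eq_bigr => i _; apply: mulrDl.
Qed.
Lemma fps_oner_neq0 : fpsC 1 != 0.
Proof. by apply/eqP => /(congr1 (@^~ 0)) /eqP; rewrite oner_eq0. Qed.

HB.instance Definition _ :=
  GRing.Zmodule_isComNzRing.Build (fps R)
    fps_mulA fps_mulC fps_mul1 fps_mulDl fps_oner_neq0.

Lemma fps_coefD f g n : (f + g) n = f n + g n. Proof. by []. Qed.
Lemma fps_coefN f n : (- f) n = - f n. Proof. by []. Qed.
Lemma fps_coef0 n : (0 : fps R) n = 0. Proof. by case: n. Qed.
Lemma fps_coef1 n : (1 : fps R) n = (n == 0)%:R. Proof. by case: n. Qed.
Lemma fps_coefM f g n : (f * g) n = \sum_(i < n.+1) f i * g (n - i)%N.
Proof. by []. Qed.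
Lemma fps_coefMn f m n : (f *+ m) n = f n *+ m.
Proof.
by elim: m => [|m IHm]; rewrite ?mulr0n ?fps_coef0 // !mulrS fps_coefD IHm.
Qed.
Lemma fps_coef_sum (I : Type) (r : seq I) (P : pred I) (F : I -> fps R) n :
  (\sum_(i <- r | P i) F i) n = \sum_(i <- r | P i) F i n.
Proof.
by apply: (big_morph (fun f : fps R => f n)) => //; apply: fps_coef0.
Qed.

Definition fpsX : fps R := fun n => (n == 1)%:R.

Lemma fps_coefXM f n : (fpsX * f) n = if n is m.+1 then f m else 0.
Proof.
rewrite fps_coefM; case: n => [|n]; first by rewrite big_ord1 mul0r.
rewrite !big_ord_recl mul0r add0r mul1r subSS subn0 big1 ?addr0 // => i _.
by rewrite /fpsX /= mul0r.
Qed.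

Lemma fps_coefXnM k f n :
  (fpsX ^+ k * f) n = if (k <= n)%N then f (n - k)%N else 0.
Proof.
elim: k n => [|k IHk] n; first by rewrite mul1r subn0.
by rewrite exprS -mulrA fps_coefXM; case: n => //= n; rewrite IHk ltnS.
Qed.

Lemma fps_coefXn k n : (fpsX ^+ k) n = (n == k)%:R.
Proof.
rewrite -[_ ^+ _]mulr1 fps_coefXnM fps_coef1 subn_eq0.
by case: ltngtP.
Qed.

Lemma fpsXI : injective (fun f : fps R => fpsX * f).
Proof.
move=> f g eq_fg; apply: funext => n.
by have /(congr1 (@^~ n.+1)) := eq_fg; rewrite /= !fps_coefXM.
Qed.

(** Cancellation of a factor with constant term 1, up to a given degree: the n-th coefficient of the
    product is [g n] plus multiples of earlier coefficients of [g], which vanish by strong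
    induction. *)
Lemma fps_mul_vanish f g N : f 0 = 1 ->
  (forall n, (n < N)%N -> (f * g) n = 0) ->
  forall n, (n < N)%N -> g n = 0.
Proof.
move=> f01 fg0 n; have [m] := ubnP n; elim: m n => // m IHm n le_nm ltnN.
have := fg0 n ltnN; rewrite fps_coefM big_ord_recl f01 mul1r subn0 big1 ?addr0 //.
move=> i _; have lt_in := ltn_ord i; rewrite IHm ?mulr0 //= /bump; lia.
Qed.

(** * Dilations, sections and supports modulo k *)

Definition dil k f : fps R := fun n => if (k %| n)%N then f (n %/ k)%N else 0.

(** While [dil k] substitutes q^k for q, [section k r] extracts the exponents congruent to r and
    contracts them; [section 5 0] is the operator U. *)
Definition section k r f : fps R := fun n => f (k * n + r)%N.

Lemma dil_coef k f n : (0 < k)%N -> dil k f (k * n)%N = f n.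
Proof. by move=> k_gt0; rewrite /dil dvdn_mulr // mulKn. Qed.

(** In the coefficient of q^(kn+r) only the exponents kj of the dilated factor contribute, and r < k
    makes j run exactly through 0, ..., n. *)
Lemma section_dilM k r f g : (r < k)%N ->
  section k r (dil k f * g) = f * section k r g.
Proof.
move=> lt_rk; apply: funext => n; rewrite /section !fps_coefM.
have k_gt0 : (0 < k)%N by lia.
rewrite (bigID (fun i : 'I__ => k %| i)%N) /= [X in _ + X]big1 ?addr0; last first.
  by move=> i /negbTE ndvd; rewrite /dil ndvd mul0r.
have lt_kj (j : 'I_n.+1) : (k * j < (k * n + r).+1)%N by have := ltn_ord j; nia.
rewrite (reindex (fun j => Ordinal (lt_kj j))) /=.
  apply: eq_big => [j|j _]; first exact: dvdn_mulr.
  rewrite dil_coef //; congr (_ * g _); have := ltn_ord j.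
  by rewrite mulnBr; nia.
have lt_dj (i : 'I_(k * n + r).+1) : (i %/ k < n.+1)%N.
  rewrite ltn_divLR //; have := ltn_ord i; nia.
exists (fun i => Ordinal (lt_dj i)) => [j _|i dvd_ki]; apply: val_inj => /=.
  by rewrite mulKn.
by rewrite mulnC; apply: divnK dvd_ki.
Qed.

Lemma section0_dil k f : (0 < k)%N -> section k 0 (dil k f) = f.
Proof. by move=> k_gt0; apply: funext => n; rewrite /section addn0 dil_coef. Qed.

Lemma section_dil_neq0 k r f : (0 < r < k)%N -> section k r (dil k f) = 0.
Proof.
move=> /andP[r0 rk]; apply: funext => n.
by rewrite /section /dil dvdn_addr ?dvdn_mulr // gtnNdvd ?fps_coef0.
Qed.

Lemma eq_section k f g : (0 < k)%N ->
  (forall r, (r < k)%N -> section k r f = section k r g) -> f = g.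
Proof.
move=> k_gt0 eq_fg; apply: funext => n; rewrite (divn_eq n k) mulnC.
by have /(congr1 (@^~ (n %/ k)%N)) := eq_fg _ (ltn_pmod n k_gt0).
Qed.

Lemma dilM k f g : (0 < k)%N -> dil k (f * g) = dil k f * dil k g.
Proof.
move=> k_gt0; apply: (eq_section k_gt0) => -[|r] rk; rewrite section_dilM //.
  by rewrite !section0_dil.
by rewrite !section_dil_neq0 ?mulr0.
Qed.

Lemma dil1 k : (0 < k)%N -> dil k 1 = 1.
Proof.
move=> k_gt0; apply: funext => n; rewrite /dil !fps_coef1.
have [/dvdnP[m ->]|ndvd] := boolP (k %| n)%N.
  by rewrite mulnK // muln_eq0 (gtn_eqF k_gt0) orbF.
by case: eqP ndvd => // ->; rewrite dvdn0.
Qed.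

Lemma sectionD k r f g : section k r (f + g) = section k r f + section k r g.
Proof. by []. Qed.

Lemma sectionN k r f : section k r (- f) = - section k r f.
Proof. by []. Qed.

Definition supported k r f := forall n, (n != r %[mod k])%N -> f n = 0.

Lemma supportedM k r s f g :
  supported k r f -> supported k s g -> supported k (r + s) (f * g).
Proof.
move=> sf sg n ne_n; rewrite fps_coefM big1 // => i _.
have [eq_i|ne_i] := eqVneq (i %% k)%N (r %% k)%N; last by rewrite sf ?mul0r.
rewrite sg ?mulr0 //; apply: contra ne_n => /eqP eq_j.
have le_in : (i <= n)%N by rewrite -ltnS.
by rewrite -(subnKC le_in) -modnDm eq_i eq_j modnDm.
Qed.

Lemma supported_coef k r f n :
  supported k r f -> (n %% k != r %% k)%N -> f n = 0.
Proof. by move=> sf; apply: sf. Qed.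

Lemma supported_dil k f : supported k 0 (dil k f).
Proof. by move=> n; rewrite mod0n /dil /dvdn => /negbTE->. Qed.

Lemma supportedD k r f g :
  supported k r f -> supported k r g -> supported k r (f + g).
Proof. by move=> sf sg n ne_n; rewrite fps_coefD sf ?sg ?addr0. Qed.

Lemma supported_mod k r s f :
  supported k r f -> (r = s %[mod k])%N -> supported k s f.
Proof. by move=> sf eq_rs n; rewrite -eq_rs; apply: sf. Qed.

Lemma section_supported k r s f :
  supported k s f -> (r %% k != s %% k)%N -> section k r f = 0.
Proof.
move=> sf ne_rs; apply: funext => n; rewrite fps_coef0 /section sf //.
by rewrite mulnC modnMDl.
Qed.

End Ring.

Arguments fpsX {R}.

(** Writing f = f(0) + q g, the Frobenius map gives f^p = f(0)^p + q^p g^p, which reduces a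
    coefficient of f^p to an earlier one of g^p. *)
Lemma fps_frobenius p (f : fps 'F_p) : prime p -> f ^+ p = dil p f.
Proof.
move=> p_pr; have p_gt0 := prime_gt0 p_pr.
have char_fps : p \in [pchar (fps 'F_p)].
  rewrite inE p_pr /=; apply/eqP/funext => n.
  by rewrite fps_coefMn fps_coef0 mulrn_pchar // pchar_Fp.
apply: funext => n; have [m] := ubnP n; elim: m n f => // m IHm n f le_nm.
pose sh : fps 'F_p := fun n => f n.+1.
have -> : f = fpsC (f 0) + fpsX * sh.
  apply: funext => -[|i]; rewrite fps_coefD fps_coefXM ?addr0 //.
  by rewrite add0r.
have fpsCX a k : (fpsC a : fps 'F_p) ^+ k = fpsC (a ^+ k).
  elim: k => // k IHk; rewrite !exprS IHk; apply: funext => i.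
  rewrite fps_coefM big_ord_recl subn0 big1 ?addr0; last by move=> j _; rewrite mul0r.
  by case: i => [|i] //=; rewrite mulr0.
rewrite -[LHS]/(((fpsC (f 0) + fpsX * sh) ^+ p) n).
rewrite exprDn_pchar ?inE ?pnat_id //; last first.
  by rewrite pnatE.
rewrite exprMn fpsCX fps_coefD fps_coefXnM.
(* Fermat's little theorem. *)
have -> : f 0 ^+ p = f 0.
  by have := expf_card (f 0); rewrite card_Fp.
rewrite /dil; case: n le_nm => [|n] le_nm.
  by rewrite leqn0 (gtn_eqF p_gt0) dvdn0 div0n fps_coefD fps_coefXM.
case: leqP => [le_pn|lt_np].
  rewrite IHm; last by lia.
  rewrite [LHS]add0r /dil dvdn_subl ?dvdnn //; case: ifP => // /dvdnP[k eq_n].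
  have k_gt0 : (0 < k)%N by case: k eq_n.
  have -> : (n.+1 - p = k.-1 * p)%N by rewrite eq_n -subn1 mulnBl mul1n.
  by rewrite eq_n !mulnK // -[in RHS](prednK k_gt0) fps_coefD fps_coefXM add0r.
by rewrite addr0 gtnNdvd.
Qed.

(** * Theta series of classes of integers *)

Lemma count_bij (T T' : eqType) (s : seq T) (s' : seq T')
    (P : pred T) (Q : pred T') (f : T -> T') (g : T' -> T) :
  uniq s -> uniq s' ->
  {in s, forall x, P x -> [/\ f x \in s', Q (f x) & g (f x) = x]} ->
  {in s', forall y, Q y -> [/\ g y \in s, P (g y) & f (g y) = y]} ->
  count P s = count Q s'.
Proof.
move=> us us' fP gQ; rewrite -!size_filter -(size_map f).
apply: perm_size; apply: uniq_perm.
- rewrite map_inj_in_uniq ?filter_uniq // => x y; rewrite !mem_filter.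
  move=> /andP[Px xs] /andP[Py ys] eq_f.
  by have [_ _ <-] := fP x xs Px; have [_ _ <-] := fP y ys Py; rewrite eq_f.
- exact: filter_uniq.
move=> y; rewrite mem_filter; apply/mapP/andP => [[x]|[Qy ys']].
  by rewrite mem_filter => /andP[Px xs] ->; have [] := fP x xs Px.
by have [gs Pg fg] := gQ y ys' Qy; exists (g y); rewrite // mem_filter Pg.
Qed.

(** The interval [-n, n]. Since |u| <= u^2 for integers, it contains every u with u^2 = n, so a
    count over it misses no representation. *)
Definition box (n : nat) : seq int := [seq i%:Z - n%:Z | i <- iota 0 (2 * n).+1].

Lemma mem_box n u : (u \in box n) = (`|u| <= n)%N.
Proof.
apply/mapP/idP => [[i]|le_un]; first by rewrite mem_iota; lia.
exists (absz (u + n%:Z)); last by lia.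
by rewrite mem_iota; lia.
Qed.

Lemma box_uniq n : uniq (box n).
Proof. by rewrite map_inj_uniq ?iota_uniq // => i j; lia. Qed.

Definition box2 (n : nat) : seq (int * int) :=
  [seq (u, v) | u <- box n, v <- box n].

Lemma mem_box2 n z : (z \in box2 n) = (`|z.1| <= n)%N && (`|z.2| <= n)%N.
Proof.
case: z => u v; rewrite -!mem_box.
by apply/allpairsP/andP => [[z [? ? [-> ->]]] //|[? ?]]; exists (u, v).
Qed.

Lemma sqr_in_box (u : int) (n : nat) : u ^+ 2 = n%:Z -> u \in box n.
Proof. by rewrite mem_box; nia. Qed.

Lemma sqr_in_box2 (u v : int) (n : nat) :
  u ^+ 2 + v ^+ 2 = n%:Z -> (u, v) \in box2 n.
Proof. by rewrite mem_box2 /= => ?; apply/andP; split; nia. Qed.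

Lemma box2_uniq n : uniq (box2 n).
Proof. by apply: allpairs_uniq => // [||[? ?] [? ?]]; rewrite ?box_uniq. Qed.

Lemma count_sum (T : Type) (a : pred T) (s : seq T) :
  count a s = (\sum_(x <- s) a x)%N.
Proof. by rewrite -sum1_count big_mkcond; apply: eq_bigr => x _; case: (a x). Qed.

Section Theta.
Variable R : comNzRingType.

(** The series of q^(u^2) over the integers u in P; [theta2] is its analogue for q^(u^2+v^2). *)
Definition theta (P : pred int) : fps R := fun n =>
  (count (fun u => P u && (u ^+ 2 == n%:Z)) (box n))%:R.

Definition theta2 (P : int -> int -> bool) : fps R := fun n =>
  (count (fun z => P z.1 z.2 && (z.1 ^+ 2 + z.2 ^+ 2 == n%:Z)) (box2 n))%:R.

(** Stated for single coefficients with possibly different exponents m and n, so that it also covers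
    rescalings of u, as dilations require. *)
Lemma theta_bij (P Q : pred int) (f g : int -> int) m n :
  (forall u, P u -> u ^+ 2 = m%:Z ->
     [/\ Q (f u), f u ^+ 2 = n%:Z & g (f u) = u]) ->
  (forall u, Q u -> u ^+ 2 = n%:Z ->
     [/\ P (g u), g u ^+ 2 = m%:Z & f (g u) = u]) ->
  theta P m = theta Q n.
Proof.
move=> fP gQ; congr _%:R; apply: (count_bij (f := f) (g := g)).
- exact: box_uniq.
- exact: box_uniq.
- move=> u _ /andP[Pu /eqP sq_u]; have [Qf sq_f gf] := fP u Pu sq_u.
  by rewrite Qf sq_f gf eqxx; split=> //; apply: sqr_in_box.
- move=> u _ /andP[Qu /eqP sq_u]; have [Pg sq_g fg] := gQ u Qu sq_u.
  by rewrite Pg sq_g fg eqxx; split=> //; apply: sqr_in_box.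
Qed.

Lemma theta2_bij (P Q : int -> int -> bool) (f g : int -> int -> int * int) m n :
  (forall u v, P u v -> u ^+ 2 + v ^+ 2 = m%:Z ->
     [/\ Q (f u v).1 (f u v).2, (f u v).1 ^+ 2 + (f u v).2 ^+ 2 = n%:Z
       & g (f u v).1 (f u v).2 = (u, v)]) ->
  (forall u v, Q u v -> u ^+ 2 + v ^+ 2 = n%:Z ->
     [/\ P (g u v).1 (g u v).2, (g u v).1 ^+ 2 + (g u v).2 ^+ 2 = m%:Z
       & f (g u v).1 (g u v).2 = (u, v)]) ->
  theta2 P m = theta2 Q n.
Proof.
move=> fP gQ; congr _%:R.
apply: (count_bij (f := fun z => f z.1 z.2) (g := fun z => g z.1 z.2)).
- exact: box2_uniq.
- exact: box2_uniq.
- move=> [u v] _ /andP[/= Puv /eqP sq_uv]; have [Qf sq_f gf] := fP u v Puv sq_uv.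
  by rewrite Qf sq_f gf eqxx; split=> //; case: (f u v) sq_f => *; apply: sqr_in_box2.
- move=> [u v] _ /andP[/= Quv /eqP sq_uv]; have [Pg sq_g fg] := gQ u v Quv sq_uv.
  by rewrite Pg sq_g fg eqxx; split=> //; case: (g u v) sq_g => *; apply: sqr_in_box2.
Qed.

Lemma thetaID Q P :
  theta P = theta (fun u => P u && Q u) + theta (fun u => P u && ~~ Q u).
Proof.
apply: funext => n; rewrite fps_coefD /theta -natrD -count_predUI.
rewrite [X in (_ + X)%N](eq_count (a2 := pred0)); last first.
  by move=> u /=; case: (P u); case: (Q u); rewrite //= andbF.
rewrite count_pred0 addn0; congr _%:R; apply: eq_count => u /=.
by case: (P u); case: (Q u); rewrite //= orbF.
Qed.

Lemma theta2ID (Q P : int -> int -> bool) :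
  theta2 P = theta2 (fun u v => P u v && Q u v)
             + theta2 (fun u v => P u v && ~~ Q u v).
Proof.
apply: funext => n; rewrite fps_coefD /theta2 -natrD -count_predUI.
rewrite [X in (_ + X)%N](eq_count (a2 := pred0)); last first.
  by move=> [u v] /=; case: (P u v); case: (Q u v); rewrite //= andbF.
rewrite count_pred0 addn0; congr _%:R; apply: eq_count => -[u v] /=.
by case: (P u v); case: (Q u v); rewrite //= orbF.
Qed.

Lemma theta_eq0 (P : pred int) n : (forall u, P u -> u ^+ 2 <> n%:Z) -> theta P n = 0.
Proof.
move=> noP; rewrite /theta (eq_count (a2 := pred0)) ?count_pred0 // => u /=.
by apply/negP => /andP[Pu /eqP]; apply: noP.
Qed.

Lemma theta_supported (P : pred int) k r :
  (forall u, P u -> (`|u| ^ 2 = r %[mod k])%N) -> supported k r (theta P).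
Proof.
move=> Pr n ne_n; apply: theta_eq0 => u Pu sq_u; case/negP: ne_n; apply/eqP.
have -> : n = (`|u| ^ 2)%N by lia.
exact: Pr.
Qed.

Lemma theta2_eq0 (P : int -> int -> bool) n :
  (forall u v, P u v -> u ^+ 2 + v ^+ 2 <> n%:Z) -> theta2 P n = 0.
Proof.
move=> noP; rewrite /theta2 (eq_count (a2 := pred0)) ?count_pred0 // => -[u v] /=.
by apply/negP => /andP[Pu /eqP]; apply: noP.
Qed.

Lemma thetaM P Q : theta P * theta Q = theta2 (fun u v => P u && Q v).
Proof.
apply: funext => n; rewrite fps_coefM.
(* All coefficients up to n are counted over the common box of n, so that the sums can be
   exchanged. *)
have widen S i : (i <= n)%N ->
    theta S i = (\sum_(u <- box n) (S u && (u ^+ 2 == i%:Z)))%:R.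
  move=> le_in; rewrite -count_sum; congr _%:R.
  apply: (count_bij (f := id) (g := id)).
  - exact: box_uniq.
  - exact: box_uniq.
  - move=> u ui Su; split=> //; move: ui; rewrite !mem_box; lia.
  - by move=> u _ /andP[Su sq_u]; rewrite mem_box Su sq_u; split=> //; nia.
rewrite (eq_bigr (fun i : 'I_n.+1 => (\sum_(u <- box n) \sum_(v <- box n)
    (P u && (u ^+ 2 == i%:Z)) * (Q v && (v ^+ 2 == (n - i)%N%:Z)))%N%:R)); last first.
  move=> i _; have le_in : (i <= n)%N by rewrite -ltnS.
  by rewrite !widen ?leq_subr // -natrM big_distrlr.
rewrite -natr_sum /theta2 count_sum big_allpairs /=; congr _%:R.
rewrite exchange_big /=; apply: eq_bigr => u _.
rewrite exchange_big /=; apply: eq_bigr => v _.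
(* For fixed u and v the splitting index i is forced to be u^2. *)
rewrite (eq_bigr (fun i : 'I_n.+1 => if i == (`|u| ^ 2)%N :> nat then
    nat_of_bool [&& P u, Q v & (v ^+ 2 == (n - `|u| ^ 2)%N%:Z)] else 0%N)); last first.
  move=> i _; have -> : (u ^+ 2 == i%:Z) = (i == (`|u| ^ 2)%N :> nat) by lia.
  by case: eqP => [->|_]; case: (P u); case: (Q v); case: (v ^+ 2 == _).
rewrite -big_mkcond (big_ord1_eq _ (fun=> _)) ltnS.
case: leqP => le_un; case: (P u); case: (Q v) => //=.
  have -> : (v ^+ 2 == (n - `|u| ^ 2)%N) = (u ^+ 2 + v ^+ 2 == n) by lia.
  by case: eqP.
by case: eqP => //; nia.
Qed.

End Theta.

Arguments theta_bij {R P Q} f g {m n}.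
Arguments theta2_bij {R P Q} f g {m n}.
Arguments thetaID {R} Q P.
Arguments theta2ID {R} Q P.

(** * The 5-dissection of phi *)

Definition cong (k r : nat) (u : int) : bool := (u %% k)%Z == r.

Section Dissection.
Variable R : comNzRingType.

Definition phi : fps R := theta R (cong 4 1).
Definition phi1 : fps R := theta R (cong 10 1).
Definition phi3 : fps R := theta R (cong 10 3).

(** Of an odd u and its opposite, exactly one is 1 modulo 4. *)
Lemma theta_odd : theta R (cong 2 1) = phi *+ 2.
Proof.
rewrite mulr2n (thetaID (cong 4 1)); congr (_ + _); apply: funext => n.
  by apply: (theta_bij id id) => u; rewrite /cong => *; split=> //; lia.
by apply: (theta_bij -%R -%R) => u; rewrite /cong sqrrN opprK => *; split=> //; lia.
Qed.

(** For u not divisible by 5, exactly one of u and -u is 1 modulo 4, and exactly one has a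
    prescribed residue among its two residues modulo 5; changing signs turns the classes 1, 4 into 1
    modulo 10 and 2, 3 into 3 modulo 10. The multiples of 5 are 5w with w = 1 modulo 4, contributing
    q^(25 w^2). *)
Lemma phi_dissection : phi = phi1 + phi3 + dil 5 (dil 5 phi).
Proof.
rewrite {1}/phi (thetaID (fun u => cong 5 1 u || cong 5 4 u)) -addrA.
congr (_ + _).
  apply: funext => n; apply: (theta_bij
    (fun u => if cong 5 1 u then u else - u)
    (fun u => if cong 4 1 u then u else - u)) => u;
  rewrite /cong => * /=; split; repeat case: ifP; lia.
rewrite (thetaID (fun u => cong 5 2 u || cong 5 3 u)).
congr (_ + _).
  apply: funext => n; apply: (theta_bij
    (fun u => if cong 5 3 u then u else - u)
    (fun u => if cong 4 1 u then u else - u)) => u;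
  rewrite /cong => * /=; split; repeat case: ifP; lia.
have dvd5 (u : int) : cong 4 1 u && ~~ (cong 5 1 u || cong 5 4 u) &&
    ~~ (cong 5 2 u || cong 5 3 u) -> exists2 w, cong 4 1 w & u = 5 * w.
  by rewrite /cong => ?; exists (u %/ 5)%Z; lia.
apply: funext => n; rewrite /dil.
have [/dvdnP[m ->]|ndvd] := boolP (5 %| n)%N; last first.
  by apply: theta_eq0 => u /dvd5[w _ ->]; lia.
rewrite mulnK //; have [/dvdnP[l ->]|ndvd] := boolP (5 %| m)%N; last first.
  by apply: theta_eq0 => u /dvd5[w _ ->]; lia.
rewrite mulnK //; apply: (theta_bij (fun u => (u %/ 5)%Z) (fun u => 5 * u)).
  by move=> u /dvd5[w mod_w ->] ?; rewrite mulKz //; split => //; lia.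
by move=> u; rewrite /cong => ? ?; rewrite mulKz //; split; lia.
Qed.

Definition odd_pairs : fps R := theta2 R (fun u v => cong 2 1 u && cong 2 1 v).

(* Multiplication by 2 + i identifies the odd Gaussian integers of norm m with
   those of norm 5m lying in the ideal (2 + i). *)
Lemma dil5_odd_pairs : dil 5 odd_pairs =
  theta2 R (fun u v => [&& cong 2 1 u, cong 2 1 v & cong 5 0 (2 * u + v)]).
Proof.
apply: funext => n; rewrite /dil.
(* Here u + iv = (2 + i)(x + iy), whence 2u + v = 5x and 2v - u = 5y; 5 divides 2v - u as soon as it
   divides 2u + v. *)
have def_uv (u v : int) : cong 5 0 (2 * u + v) ->
    exists z : int * int, u = 2 * z.1 - z.2 /\ v = z.1 + 2 * z.2.
  rewrite /cong => ?; exists ((2 * u + v) %/ 5, (2 * v - u) %/ 5)%Z => /=.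
  by split; lia.
have [/dvdnP[m ->]|ndvd] := boolP (5 %| n)%N; last first.
  apply/esym/theta2_eq0 => u v /and3P[_ _ /def_uv[[x y] /= [-> ->]]].
  by move=> ?; have : (5 * (x ^+ 2 + y ^+ 2) = n)%R; lia.
rewrite mulnK //; apply: (theta2_bij
  (fun x y => (2 * x - y, x + 2 * y))
  (fun u v => ((2 * u + v) %/ 5, (2 * v - u) %/ 5)%Z)) => [x y|u v] /=.
  by rewrite /cong => *; split; [lia|lia|congr pair; lia].
move=> /and3P[ou ov /def_uv[[x y] /= [def_u def_v]]]; subst u v.
move: ou ov; rewrite /cong => *.
have -> : ((2 * (2 * x - y) + (x + 2 * y)) %/ 5 = x)%Z by lia.
have -> : ((2 * (x + 2 * y) - (2 * x - y)) %/ 5 = y)%Z by lia.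
by split => //; lia.
Qed.

(** If 5 divides 2u + v and u, it divides v too, so these pairs are 5 times the odd pairs. *)
Lemma dil25_odd_pairs : dil 5 (dil 5 odd_pairs) =
  theta2 R (fun u v =>
    [&& cong 2 1 u, cong 2 1 v & cong 5 0 (2 * u + v)] && cong 5 0 u).
Proof.
apply: funext => n; rewrite /dil.
have def_uv (u v : int) :
    [&& cong 2 1 u, cong 2 1 v & cong 5 0 (2 * u + v)] && cong 5 0 u ->
    exists z, [/\ u = 5 * z.1, v = 5 * z.2 & cong 2 1 z.1 && cong 2 1 z.2].
  rewrite /cong => ?; exists (u %/ 5, v %/ 5)%Z => /=.
  by split; lia.
have mulK5 (x : int) : (5 * x %/ 5)%Z = x by lia.
have [/dvdnP[m ->]|ndvd] := boolP (5 %| n)%N; last first.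
  by apply/esym/theta2_eq0 => u v /def_uv[[x y] /= [-> -> _]]; lia.
rewrite mulnK //; have [/dvdnP[l ->]|ndvd] := boolP (5 %| m)%N; last first.
  by apply/esym/theta2_eq0 => u v /def_uv[[x y] /= [-> -> _]]; lia.
rewrite mulnK //; apply: (theta2_bij
  (fun x y => (5 * x, 5 * y)) (fun u v => (u %/ 5, v %/ 5)%Z)) => [x y|u v] /=.
  by rewrite !mulK5 /cong => *; split => //; lia.
move=> /def_uv[[x y] /= [-> -> odd_xy]]; rewrite !mulK5 => *.
by split=> //; lia.
Qed.

(** Both sides count the odd pairs with 5 dividing 2u + v, sorted by u modulo 5. Those with u = 0
    give the 25-fold dilation. Otherwise (u, v) is (1, 3), (2, 1), (3, 4) or (4, 2) modulo 5, and
    multiplication by a power of i carries each class to (1, 3), counted by [phi1 * phi3]. The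
    factor 4 stays because R is arbitrary. *)
Lemma phi1M_phi3 :
  dil 5 (phi ^+ 2) *+ 4 = (phi1 * phi3) *+ 4 + dil 5 (dil 5 (phi ^+ 2)) *+ 4.
Proof.
have dilMn k f m : dil k (f *+ m) = dil k f *+ m :> fps R.
  apply: funext => n; rewrite fps_coefMn /dil; case: ifP => // _.
    exact: fps_coefMn.
  by rewrite mul0rn.
have odd2 : phi ^+ 2 *+ 4 = odd_pairs.
  by rewrite /odd_pairs -thetaM theta_odd; ring.
rewrite -!dilMn odd2 dil25_odd_pairs dil5_odd_pairs.
rewrite (theta2ID (fun u _ => cong 5 0 u)) addrC; congr (_ + _).
have -> (x : fps R) : x *+ 4 = x + (x + (x + x)) by ring.
rewrite thetaM.
rewrite (theta2ID (fun u _ => cong 5 1 u)); congr (_ + _).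
  apply: funext => n; apply: (theta2_bij pair pair) => u v /=;
    rewrite /cong => *; split=> //; lia.
rewrite (theta2ID (fun u _ => cong 5 2 u)); congr (_ + _).
  apply: funext => n.
  apply: (theta2_bij (fun u v => (v, - u)) (fun u v => (- v, u))) => u v /=;
    rewrite /cong => *; split; rewrite ?opprK //; lia.
rewrite (theta2ID (fun u _ => cong 5 3 u)); congr (_ + _).
  apply: funext => n.
  apply: (theta2_bij (fun u v => (- v, u)) (fun u v => (v, - u))) => u v /=;
    rewrite /cong => *; split; rewrite ?opprK //; lia.
apply: funext => n.
apply: (theta2_bij (fun u v => (- u, - v)) (fun u v => (- u, - v))) => u v /=;
  rewrite /cong => *; split; rewrite ?opprK //; lia.
Qed.

End Dissection.

(** * The generating function of pod and Gauss's identity *)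

Definition pod_seqs (n : nat) : seq (seq nat) :=
  [seq map val (s : n.-bseq 'I_n.+1) | s in [set s : n.-bseq 'I_n.+1 |
      is_partition n (map val s) && odd_parts_distinct (map val s)]].

Definition pod_le (k n : nat) : nat := count (all (leq^~ k)) (pod_seqs n).

Lemma pod_seqs_uniq n : uniq (pod_seqs n).
Proof.
rewrite map_inj_uniq ?enum_uniq // => s t eq_st.
by apply: val_inj; apply: (inj_map val_inj).
Qed.

Lemma mem_pod_seqs n p :
  (p \in pod_seqs n) = is_partition n p && odd_parts_distinct p.
Proof.
apply/imageP/andP => [[s] | [part_p odd_p]].
  by rewrite inE => /andP[? ?] ->.
have [s def_p] := partition_bseq part_p.
by exists s; rewrite ?inE def_p ?part_p.
Qed.

Lemma pod_seqs_all n p : p \in pod_seqs n -> all (leq^~ n) p.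
Proof.
rewrite mem_pod_seqs => /andP[/and3P[_ _ /eqP <-] _].
elim: p => //= x p IHp; rewrite leq_addr.
by apply: sub_all IHp => y /= le_y; apply: leq_trans le_y (leq_addl _ _).
Qed.

Lemma pod_leE k n : (n <= k)%N -> pod_le k n = pod n.
Proof.
move=> le_nk; rewrite /pod_le (eq_in_count (a2 := predT)) => [|p /pod_seqs_all le_p].
  by rewrite count_predT size_map -cardE.
by apply: sub_all le_p => x /leq_trans->.
Qed.

Lemma pod_le0 n : pod_le 0 n = (n == 0).
Proof.
rewrite /pod_le (eq_in_count (a2 := pred1 [::])) => [|p].
  rewrite -/(count_mem _ _) count_uniq_mem ?pod_seqs_uniq // mem_pod_seqs.
  by rewrite /is_partition /= andbT eq_sym.
rewrite mem_pod_seqs => /andP[/and3P[_ p_gt0 _] _].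
by case: p p_gt0 => [|[|x] p].
Qed.

(** Partitions in which k+1 occurs lose one copy of it, their first part. If k+1 is odd it may not
    occur again, so the remaining parts are at most k. *)
Lemma pod_leS k n : pod_le k.+1 n =
  (pod_le k n
   + if k < n then pod_le (if odd k.+1 then k else k.+1) (n - k.+1) else 0)%N.
Proof.
have split_count : pod_le k.+1 n = (pod_le k n +
    count (fun p => all (leq^~ k.+1) p && ~~ all (leq^~ k) p) (pod_seqs n))%N.
  rewrite /pod_le -count_predUI [X in (_ + X)%N](eq_count (a2 := pred0)) => [|p /=].
    rewrite count_pred0 addn0; apply: eq_count => p /=.
    have [le_pk|_] := boolP (all (leq^~ k) p); last by rewrite andbT.
    by apply: sub_all le_pk => x /leqW.
  by rewrite andbCA andbN andbF.
rewrite split_count; congr addn.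
have trans_geq : transitive geq by move=> x y z /= xy yz; apply: leq_trans yz xy.
case: ltnP => [lt_kn|le_nk]; last first.
  apply/eqP; rewrite -leqn0 leqNgt -has_count; apply/hasPn => p p_n.
  rewrite negb_and negbK orbC; apply/orP; left.
  by apply: sub_all (pod_seqs_all p_n) => x /leq_trans->.
apply: (count_bij (f := behead) (g := cons k.+1)); rewrite ?pod_seqs_uniq //.
  move=> [|x p]; rewrite ?andbF // mem_pod_seqs.
  case/andP=> /and3P[]; rewrite /sorted path_sortedE // => /andP[ge_x sort_p].
  move=> /andP[x_gt0 p_gt0] /eqP sum_p odd_p /andP[/andP[le_xk le_pk]].
  have def_x : ~~ all (leq^~ k) (x :: p) -> x = k.+1.
    have [le_x_k|lt_kx _] := leqP x k; last by apply/eqP; rewrite eqn_leq le_xk.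
    rewrite /= le_x_k => /negP[]; apply: sub_all ge_x => y /= le_yx.
    exact: leq_trans le_yx le_x_k.
  move/def_x => {def_x} def_x; subst x; split=> //.
    rewrite mem_pod_seqs /is_partition sort_p [all _ _]p_gt0 -sum_p /= addKn eqxx /=.
    by move: odd_p; rewrite /odd_parts_distinct /=; case: ifP => //= _ /andP[].
  case: ifP => // odd_k; apply/allP => y y_p.
  have : y != k.+1.
    apply: contraTneq odd_p => def_y; subst y.
    by rewrite /odd_parts_distinct /= (odd_k : ~~ odd k) /= mem_filter y_p odd_k.
  by move/allP/(_ y y_p): le_pk => /=; lia.
move=> p; rewrite mem_pod_seqs => /andP[/and3P[sort_p p_gt0 /eqP sum_p] odd_p] le_p.
have le_pk : all (leq^~ k.+1) p.
  by apply: sub_all le_p => x; case: ifP => // _ /leqW.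
split=> //=; last by rewrite leqnn le_pk ltnn.
rewrite mem_pod_seqs /is_partition /= path_sortedE // sort_p p_gt0 sum_p.
rewrite subnKC // eqxx le_pk /= /odd_parts_distinct /=.
move: le_p => /=; case: (~~ odd k) => //= le_p.
rewrite [uniq _]odd_p andbT mem_filter.
by apply/negP => /andP[_] /(allP le_p); rewrite ltnn.
Qed.

(** Induction on n. Passing from n to n+1 multiplies the right side by 1 - x^(2n+1) and adds the two
    new triangular powers, times the product of the first n+1 odd factors. *)
Lemma shanks_identity (R : comNzRingType) (x : R) n :
  (\prod_(i < n) (1 - x ^+ (2 * i + 1))) * (\sum_(j < 2 * n) x ^+ 'C(j.+1, 2))
  = \sum_(s < n) (\prod_(s <= i < n) (1 - x ^+ (2 * i + 2)))
       * (\prod_(i < s) (1 - x ^+ (2 * i + 1))) * x ^+ (s * (2 * n + 1)).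
Proof.
pose O s := \prod_(i < s) (1 - x ^+ (2 * i + 1)).
pose E s n := \prod_(s <= i < n) (1 - x ^+ (2 * i + 2)).
have OS s : O s.+1 = O s * (1 - x ^+ (2 * s + 1)) by rewrite /O big_ord_recr.
have ES s m : (s <= m)%N -> E s m.+1 = E s m * (1 - x ^+ (2 * m + 2)).
  by move=> le_sm; rewrite /E big_nat_recr.
have EL s m : (s < m)%N -> E s m = (1 - x ^+ (2 * s + 2)) * E s.+1 m.
  by move=> lt_sm; rewrite /E big_ltn.
have En m : E m m = 1 by rewrite /E big_geq.
rewrite -/(O n) -[RHS]/(\sum_(s < n) E s n * O s * x ^+ (s * (2 * n + 1))).
elim: n => [|n IHn]; first by rewrite muln0 !big_ord0 mulr0.
(* The defect of the recurrence on the first k terms collapses to one term, so at k = n only it and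
   the new summand s = n remain. *)
have telescope k : (k <= n)%N ->
    \sum_(s < k) (E s n.+1 * O s * x ^+ (s * (2 * n.+1 + 1)))
      - (1 - x ^+ (2 * n + 1)) * \sum_(s < k) (E s n * O s * x ^+ (s * (2 * n + 1)))
    = E k n * (1 - x ^+ (2 * k)) * O k * x ^+ (k * (2 * n + 1)).
  elim: k => [|k IHk] le_kn.
    by rewrite !big_ord0 muln0 expr0 subrr !(mulr0, mul0r) subr0.
  have {IHk} := IHk (ltnW le_kn); move/eqP; rewrite subr_eq => /eqP eq_k.
  rewrite !big_ord_recr /= eq_k (ES _ _ (ltnW le_kn)) OS (EL k n) //.
  have -> : (k * (2 * n.+1 + 1) = k * (2 * n + 1) + 2 * k)%N by lia.
  have -> : (k.+1 * (2 * n + 1) = k * (2 * n + 1) + (2 * n + 1))%N by lia.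
  have -> : (2 * k.+1 = 2 * k + 2)%N by lia.
  rewrite !exprD; ring.
have := telescope n (leqnn n); rewrite -IHn => /eqP; rewrite subr_eq => /eqP eq_n.
rewrite [RHS]big_ord_recr /= eq_n (ES n) // En OS.
have -> : (2 * n.+1 = (2 * n).+2)%N by lia.
rewrite !big_ord_recr /=.
have -> : ('C((2 * n).+1, 2) = n * (2 * n + 1))%N by rewrite bin2 /=; lia.
have -> : ('C((2 * n).+2, 2) = n * (2 * n + 1) + (2 * n + 1))%N by rewrite bin2; lia.
have -> : (n * ((2 * n).+2 + 1) = n * (2 * n + 1) + 2 * n)%N by lia.
rewrite !exprD; ring.
Qed.

Section Gauss.
Variable R : comNzRingType.

(* podgf (2 * n) is the product of the (1 - q^(2i-1)) / (1 - q^(2i)) for i <= n: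
   the sign replaces q by -q. *)
Definition podgf k : fps R := fun n => (-1) ^+ n * (pod_le k n)%:R.

Lemma podgf0 : podgf 0 = 1.
Proof.
apply: funext => n; rewrite /podgf pod_le0 fps_coef1.
by case: n => [|n]; rewrite ?mulr1 ?mulr0.
Qed.

Lemma podgfS k : podgf k.+1 =
  podgf k + (-1) ^+ k.+1 * fpsX ^+ k.+1 * podgf (if odd k.+1 then k else k.+1).
Proof.
apply: funext => n; rewrite fps_coefD -signr_odd mulr_sign.
have -> : ((if odd k.+1 then - fpsX ^+ k.+1 else fpsX ^+ k.+1 : fps R)
    * podgf (if odd k.+1 then k else k.+1)) n
    = (-1) ^+ k.+1 * (fpsX ^+ k.+1 * podgf (if odd k.+1 then k else k.+1)) n.
  rewrite -[in RHS]signr_odd mulr_sign.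
  by case: ifP => _; rewrite ?mulNr ?fps_coefN.
rewrite fps_coefXnM /podgf pod_leS natrD mulrDr; congr (_ + _).
case: ltnP => lt_kn; last by rewrite !mulr0.
by rewrite mulrA -exprD subnKC.
Qed.

(** By [podgfS], admitting the part 2n+1 multiplies by 1 - q^(2n+1), and admitting 2n+2 divides by 1
    - q^(2n+2). *)
Lemma podgf_prod n : (\prod_(i < n) (1 - fpsX ^+ (2 * i + 2))) * podgf (2 * n)
  = \prod_(i < n) (1 - fpsX ^+ (2 * i + 1)).
Proof.
elim: n => [|n IHn]; first by rewrite !big_ord0 mul1r podgf0.
rewrite !big_ord_recr /= -IHn -!mulrA; congr (_ * _).
have -> : (2 * n.+1 = (2 * n).+2)%N by lia.
have := podgfS (2 * n).+1; have := podgfS (2 * n).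
rewrite /= mul2n odd_double /= -mul2n.
rewrite -[(-1) ^+ (2 * n).+2]signr_odd -[(-1) ^+ (2 * n).+1]signr_odd /=.
rewrite mul2n odd_double /=.
rewrite -mul2n expr0 expr1 addn1 addn2 => -> E.
transitivity (podgf (2 * n).+2 - fpsX ^+ (2 * n).+2 * podgf (2 * n).+2); first by ring.
rewrite {1}E; ring.
Qed.

Lemma fps_coef0_prod n (F : 'I_n -> fps R) :
  (\prod_(i < n) F i) 0%N = \prod_(i < n) F i 0%N.
Proof.
elim: n F => [|n IHn] F; first by rewrite !big_ord0.
by rewrite !big_ord_recr /= fps_coefM big_ord1 IHn.
Qed.

(** After multiplication by the product of the 1 - q^(2i+2), whose constant term is 1, this is
    Shanks's identity modulo q^(2n+1). *)
Lemma gauss_podgf n : (0 < n)%N -> forall m, (m <= 2 * n)%N ->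
  (podgf (2 * n) * \sum_(j < 2 * n) fpsX ^+ 'C(j.+1, 2)) m = (m == 0%N)%:R.
Proof.
move=> n_gt0 m le_m; apply/eqP; rewrite -subr_eq0 -fps_coef1 -fps_coefN -fps_coefD.
apply/eqP; apply: (@fps_mul_vanish _
  (\prod_(i < n) (1 - fpsX ^+ (2 * i + 2))) _ (2 * n).+1) => //.
  rewrite fps_coef0_prod big1 // => i _.
  by rewrite fps_coefD fps_coefN fps_coefXn addn2 subr0.
move=> {m le_m} m le_m.
rewrite mulrDr mulrA podgf_prod. rewrite shanks_identity mulrN1.
case: n n_gt0 le_m => // n _ le_m.
(* The term s = 0 is the even product itself and cancels; every term with s > 0 is divisible by
   q^(2n+1). *)
rewrite [\sum_(s < _) _]big_ord_recl big_ord0 mulr1 mul0n mulr1 big_mkord.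
rewrite addrAC subrr add0r.
rewrite fps_coef_sum big1 // => i _; rewrite mulrC fps_coefXnM ifN // -ltnNge.
by rewrite lift0 mulSn; lia.
Qed.

End Gauss.

(** * The relation between pod and phi *)

Section PodPhi.
Variable R : comNzRingType.

(** This is psi(q), from (2j+1)^2 = 8 j(j+1)/2 + 1. Truncation at N is harmless because j(j+1)/2 >=
    j. *)
Lemma section_phi N n : (n < N)%N ->
  section 8 1 (phi R) n = (\sum_(j < N) fpsX ^+ 'C(j.+1, 2)) n.
Proof.
move=> lt_nN; rewrite fps_coef_sum.
rewrite -(big_mkord xpredT (fun j => (fpsX ^+ 'C(j.+1, 2) : fps R) n)).
rewrite (eq_bigr (fun j => (n == 'C(j.+1, 2))%:R)) => [|j _]; last exact: fps_coefXn.
rewrite -natr_sum -count_sum /section /phi /theta; congr _%:R.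
have bin_tri j : ('C(j.+1, 2) * 8 + 1 = (2 * j + 1) ^ 2)%N.
  elim: j => // j IHj; rewrite binS bin1; lia.
(* The root of (2j+1)^2 that is 1 modulo 4 is 2j+1 for even j and its opposite for odd j. *)
apply: (count_bij (f := fun u => (`|u| %/ 2)%N)
  (g := fun j => if odd j then - (2 * j%:Z + 1) else 2 * j%:Z + 1)).
- exact: box_uniq.
- exact: iota_uniq.
- move=> u _ /andP[]; rewrite /cong => mod_u /eqP sq_u.
  have abs_u : `|u|%N = (2 * (`|u| %/ 2) + 1)%N by lia.
  have tri_u := bin_tri (`|u| %/ 2)%N; rewrite -abs_u in tri_u.
  rewrite mem_index_iota; split; [nia|apply/eqP; nia|case: ifP; lia].
move=> j _ /eqP def_n; have tri_j := bin_tri j; rewrite -def_n in tri_j.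
have abs_g : absz (if odd j then - (2 * j%:Z + 1) else 2 * j%:Z + 1) = (2 * j + 1)%N.
  by case: ifP; lia.
split; [rewrite mem_box abs_g; nia| |by rewrite abs_g; lia].
by rewrite /cong; apply/andP; split; [case: ifP; lia|apply/eqP; case: ifP; nia].
Qed.

Lemma phi_dil8 : phi R = fpsX * dil 8 (section 8 1 (phi R)).
Proof.
have phi8 : supported 8 1 (phi R).
  move=> n ne_n; apply: theta_eq0 => u; rewrite /cong => mod_u sq_u.
  have [k def_u] : exists k, u = 4 * k + 1 by exists (u %/ 4)%Z; lia.
  by subst u; lia.
apply: (@eq_section _ 8) => // r r8; rewrite mulrC section_dilM //.
have [->|ne_r1] := eqVneq r 1%N.
  rewrite -[LHS]mulr1; congr (_ * _); apply: funext => n.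
  by rewrite /section /fpsX fps_coef1 addn1 eqSS muln_eq0.
rewrite (section_supported phi8) ?modn_small //.
have -> : section 8 r fpsX = 0 :> fps R; last by rewrite mulr0.
apply: funext => n; rewrite /section /fpsX fps_coef0.
by case: eqP => //; lia.
Qed.

Lemma pod_phi :
  dil 8 (fun n => (-1) ^+ n * (pod n)%:R) * phi R = fpsX.
Proof.
rewrite phi_dil8 mulrCA -dilM // [X in dil 8 X](_ : _ = 1) ?dil1 ?mulr1 //.
(* For the coefficient of q^m, parts and summands may be truncated at 2(m+1). *)
apply: funext => m; rewrite fps_coef1 -(@gauss_podgf R m.+1) //; last by lia.
rewrite !fps_coefM; apply: eq_bigr => i _; have lt_i := ltn_ord i.
congr (_ * _); first by rewrite /podgf pod_leE //; lia.
by apply: section_phi; lia.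
Qed.

End PodPhi.

(** * Reduction modulo 5 *)

Section Mod5.

Local Notation F := (fps 'F_5).
Local Notation f := (phi 'F_5).
Local Notation a := (phi1 'F_5).
Local Notation b := (phi3 'F_5).
Local Notation d := (dil 5 f).
Local Notation c := (dil 5 d).

(** Since [ring] does not know the characteristic, multiples of 5 are inserted by hand through this
    lemma. *)
Lemma fps_five (g : F) : g *+ 5 = 0.
Proof. by apply: funext => n; rewrite fps_coefMn fps_coef0 mulrn_pchar // pchar_Fp. Qed.

Lemma supported_phi1 : supported 5 1 a.
Proof. by apply: theta_supported => u; rewrite /cong; nia. Qed.

Lemma supported_phi3 : supported 5 4 b.
Proof. by apply: theta_supported => u; rewrite /cong; nia. Qed.

Lemma phi1M_phi3_mod5 : a * b = d ^+ 2 - c ^+ 2.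
Proof.
have := phi1M_phi3 'F_5; rewrite !expr2 !dilM // -!expr2 => eq4.
have opp4 (g : F) : - (g *+ 4) = g by rewrite -[RHS]addr0 -(fps_five (- g)); ring.
by rewrite -(opp4 (d ^+ 2)) eq4 opprD !opp4 addrK.
Qed.

(** Expand (a + b + c)^3 with ab + c^2 = d^2: 3a^2 b + 3a c^2 = 3a d^2, likewise for b, and c^3 +
    6abc = c d^2 modulo 5. The remaining terms have exponents 2 or 3 modulo 5. *)
Lemma phi_cube : exists t2 t3,
  [/\ supported 5 2 t2, supported 5 3 t3
    & f ^+ 3 = d ^+ 2 * (a *+ 3 + b *+ 3 + c) + (t2 + t3)].
Proof.
have sa := supported_phi1; have sb := supported_phi3.
have sc : supported 5 0 c by apply: supported_dil.
have supMn r (g : F) m : supported 5 r g -> supported 5 r (g *+ m).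
  by move=> sg n ne_n; rewrite fps_coefMn sg ?mul0rn.
exists (b * b * b + (a * a * c) *+ 3), (a * a * a + (b * b * c) *+ 3); split.
- apply: supportedD; last apply: supMn.
    exact: supported_mod (supportedM (supportedM sb sb) sb) _.
  exact: supported_mod (supportedM (supportedM sa sa) sc) _.
- apply: supportedD; last apply: supMn.
    exact: supported_mod (supportedM (supportedM sa sa) sa) _.
  exact: supported_mod (supportedM (supportedM sb sb) sc) _.
have -> : d ^+ 2 = a * b + c ^+ 2 by rewrite phi1M_phi3_mod5 subrK.
rewrite {1}phi_dissection -[LHS]subr0 -(fps_five (a * b * c)).
ring.
Qed.

Lemma section_phi_mul_dil (g : F) r : (r < 5)%N ->
  section 5 r (d ^+ 2 * g) = f ^+ 2 * section 5 r g.
Proof. by move=> r5; rewrite expr2 -dilM // section_dilM // expr2. Qed.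

(** Multiplying [phi_cube] by a + b + c, the part with exponents divisible by 5 is d^2 (6ab + c^2) =
    d^4 modulo 5. *)
Lemma section_phi4 : section 5 0 (f ^+ 4) = f ^+ 4.
Proof.
have sa := supported_phi1; have sb := supported_phi3.
have sc : supported 5 0 c by apply: supported_dil.
have [t2 [t3 [s2 s3 cube]]] := phi_cube.
have {1}-> : f ^+ 4 = d ^+ 2 *
    (d * d + ((a * a + b * b) *+ 3 + (a * c + b * c) *+ 4))
                   + (a * t2 + a * t3 + b * t2 + b * t3 + c * t2 + c * t3).
  have -> : d * d = a * b + c ^+ 2 by rewrite phi1M_phi3_mod5 subrK expr2.
  rewrite exprS cube {1}phi_dissection -[LHS]subr0 -(fps_five (d ^+ 2 * a * b)).
  ring.
have sec0 r s (g h : F) : supported 5 r g -> supported 5 s h ->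
    ((r + s) %% 5 != 0)%N -> section 5 0 (g * h) = 0.
  move=> sg sh ne_rs; apply: (section_supported (supportedM sg sh)).
  by rewrite eq_sym.
rewrite !sectionD section_phi_mul_dil // !sectionD.
rewrite section_dilM // section0_dil //.
rewrite (sec0 _ _ _ _ sa sa) // (sec0 _ _ _ _ sb sb) //.
rewrite (sec0 _ _ _ _ sa sc) // (sec0 _ _ _ _ sb sc) //.
rewrite (sec0 _ _ _ _ sa s2) // (sec0 _ _ _ _ sa s3) //.
rewrite (sec0 _ _ _ _ sb s2) // (sec0 _ _ _ _ sb s3) //.
rewrite (sec0 _ _ _ _ sc s2) // (sec0 _ _ _ _ sc s3) //.
ring.
Qed.

Lemma section_phi3 : section 5 0 (f ^+ 3) = f ^+ 2 * d.
Proof.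
have sa := supported_phi1; have sb := supported_phi3.
have [t2 [t3 [s2 s3 ->]]] := phi_cube.
rewrite sectionD section_phi_mul_dil // !sectionD section0_dil //.
rewrite (section_supported sa) // (section_supported sb) //.
by rewrite (section_supported s2) // (section_supported s3) // !add0r !addr0.
Qed.

(** The exponents divisible by 5 come from c^2 + 2ab = 2d^2 - c^2. *)
Lemma section_phi2 : section 5 0 (f ^+ 2) = (f ^+ 2) *+ 2 - d ^+ 2.
Proof.
have sa := supported_phi1; have sb := supported_phi3.
have sc : supported 5 0 c by apply: supported_dil.
have {1}-> : f ^+ 2 = d * (d *+ 2) - c * c
                   + (a * a + b * b + (a * c) *+ 2 + (b * c) *+ 2).
  have -> : d * (d *+ 2) = (a * b + c ^+ 2) *+ 2.
    by rewrite phi1M_phi3_mod5 subrK mulrnAr expr2.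
  rewrite {1}phi_dissection; ring.
have sec0 r s (g h : F) : supported 5 r g -> supported 5 s h ->
    ((r + s) %% 5 != 0)%N -> section 5 0 (g * h) = 0.
  move=> sg sh ne_rs; apply: (section_supported (supportedM sg sh)).
  by rewrite eq_sym.
rewrite !sectionD sectionN !section_dilM // sectionD !section0_dil //.
rewrite (sec0 _ _ _ _ sa sa) // (sec0 _ _ _ _ sb sb) //.
rewrite (sec0 _ _ _ _ sa sc) // (sec0 _ _ _ _ sb sc) //.
ring.
Qed.

Lemma phi3_coef25 n : (f ^+ 3) (25 * n)%N = (f ^+ 3 *+ 2 - f * d ^+ 2) n.
Proof.
have -> : (f ^+ 3) (25 * n)%N = section 5 0 (section 5 0 (f ^+ 3)) n.
  by rewrite /section !addn0 mulnA.
rewrite section_phi3 mulrC section_dilM // section_phi2.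
congr ((_ : F) n); ring.
Qed.

Lemma phi3_coef25_pm1 n : (n %% 5 = 1)%N \/ (n %% 5 = 4)%N ->
  (f ^+ 3) (25 * n)%N = 0.
Proof.
move=> mod_n; rewrite phi3_coef25.
have [t2 [t3 [s2 s3 cube]]] := phi_cube.
(* The coefficient of d^2 (a + b) is 6 - 1 = 5, so the classes 1 and 4 disappear. *)
have -> : f ^+ 3 *+ 2 - f * d ^+ 2 = c * (d * d) + (t2 *+ 2 + t3 *+ 2).
  rewrite cube {3}phi_dissection -[RHS]addr0 -(fps_five (d ^+ 2 * (a + b))).
  ring.
rewrite !fps_coefD !fps_coefMn s2 ?s3; try by case: mod_n => ->.
rewrite -!dilM // (supported_coef (supported_dil _)) ?mul0rn ?addr0 //.
by case: mod_n => ->.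
Qed.

Lemma phi3_coef125 n : (f ^+ 3) (25 * (5 * n))%N = (f ^+ 3) (5 * n)%N.
Proof.
rewrite phi3_coef25; have [t2 [t3 [s2 s3 cube]]] := phi_cube.
(* The difference from [f ^+ 3] has no exponent divisible by 5. *)
have -> : f ^+ 3 *+ 2 - f * d ^+ 2
    = f ^+ 3 + (t2 + t3 + (d * d * a) *+ 2 + (d * d * b) *+ 2).
  by rewrite mulr2n -addrA {2}cube {4}phi_dissection; congr (_ + _); ring.
have sdd : supported 5 0 (d * d) by rewrite -dilM //; apply: supported_dil.
have mod0 r : (r %% 5 != 0)%N -> (5 * n != r %[mod 5])%N by rewrite modnMr eq_sym.
rewrite !fps_coefD !fps_coefMn s2 ?s3 ?mod0 //.
rewrite (supportedM sdd supported_phi1) ?mod0 //.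
by rewrite (supportedM sdd supported_phi3) ?mod0 // !mul0rn !addr0.
Qed.

(** Here p = q / phi. Since phi^5 = phi(q^5), one has phi(q^5) p = q phi^4; taking exponents 1
    modulo 5 gives phi times the section of p on the left and U(phi^4) = phi^4 on the right. *)
Lemma phi_inverse_section (p : F) : p * f = fpsX -> section 5 1 p = f ^+ 3.
Proof.
move=> pf.
have : section 5 1 p * f = f ^+ 4.
  rewrite -section_phi4 mulrC -section_dilM // -(fps_frobenius f) //.
  have -> : f ^+ 5 * p = fpsX * f ^+ 4 by rewrite -pf; ring.
  by apply: funext => n; rewrite /section addn1 fps_coefXM addn0.
(* As phi has constant term 0, it is cancelled by multiplying with p, which turns it into q. *)
move=> /(congr1 (fun g => p * g)) eq_p; apply: fpsXI.
rewrite /= -pf; transitivity (p * (section 5 1 p * f)); first by ring.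
by rewrite eq_p; ring.
Qed.

Lemma pod_coef_phi3 N k : (8 * N = 5 * k + 1)%N ->
  (pod N = 0 %[mod 5])%N <-> (f ^+ 3) k = 0.
Proof.
move=> def_N; rewrite -(phi_inverse_section (pod_phi 'F_5)).
rewrite /section -def_N dil_coef // mod0n.
rewrite -signr_odd mulr_sign.
have -> : (pod N %% 5 = 0)%N <-> (pod N)%:R = 0 :> 'F_5.
  have p5 : 5%N \in [pchar 'F_5] by exact: pchar_Fp.
  by have := dvdn_pcharf p5 (pod N); rewrite /dvdn => e;
    split=> /eqP pod0; apply/eqP; rewrite ?e // -e.
by case: (odd N) => //; split=> [->|/eqP]; rewrite ?oppr0 // oppr_eq0 => /eqP.
Qed.

Lemma phi3_coef_pow25 alpha m : (0 < alpha)%N ->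
  (m %% 5 = 1)%N \/ (m %% 5 = 4)%N -> (f ^+ 3) (25 ^ alpha * m)%N = 0.
Proof.
move=> alpha_gt0 mod_m; case: alpha alpha_gt0 => // alpha _.
elim: alpha => [|alpha IHalpha]; first by rewrite expn1 phi3_coef25_pm1.
rewrite -[RHS]IHalpha.
(* The exponent must show a factor 5 for [phi3_coef125]; powers of 25 are removed down to the first,
   where [phi3_coef25_pm1] applies. *)
have -> : (25 ^ alpha.+1 * m = 5 * (5 * (25 ^ alpha * m)))%N by rewrite expnS; lia.
rewrite -phi3_coef125; congr ((_ : fps _) _); rewrite !expnS; lia.
Qed.

End Mod5.

Local Close Scope ring_scope.

Theorem theorem4 (n alpha : nat) (halpha : 1 <= alpha) :
  pod (5 ^ (2 * alpha + 2) * n + (11 * 5 ^ (2 * alpha + 1) + 1) %/ 8)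
    = 0 %[mod 5]
  /\
  pod (5 ^ (2 * alpha + 2) * n + (19 * 5 ^ (2 * alpha + 1) + 1) %/ 8)
    = 0 %[mod 5].
Proof.
have /andP[dvd11 dvd19] := dvd8_offset alpha.
have pow1 : (5 ^ (2 * alpha + 1) = 5 * 25 ^ alpha)%N by rewrite addn1 expnS expnM.
have pow2 : (5 ^ (2 * alpha + 2) = 25 * 25 ^ alpha)%N.
  by rewrite addn2 !expnS expnM mulnA.
rewrite pow1 pow2 in dvd11 dvd19 *.
split.
(* Multiplying the argument of [pod] by 8 gives 5 k + 1 with this k; 40n + 11 is 1 modulo 5, and 40n
   + 19 below is 4. *)
- apply/(pod_coef_phi3 (k := 25 ^ alpha * (40 * n + 11))); first by lia.
  by apply: phi3_coef_pow25 => //; left; lia.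
- apply/(pod_coef_phi3 (k := 25 ^ alpha * (40 * n + 19))); first by lia.
  by apply: phi3_coef_pow25 => //; right; lia.
Qed.
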